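(* For every real number $x \in (0, \pi/2)$, $$\frac{\sinh x}{x} + \left(\frac{x}{\tan x}\right)^2 < 2 - \frac{x^2}{6} < 2 < 2 + \frac{x^5}{45 \tan x} < \left(\frac{\sinh x}{x}\right)^2 + \frac{x}{\tan x}.$$ *)

(* Defs.v *)
From Stdlib Require Export Reals.

(* Main.v *)
(** With [y = x^2], the claims reduce to polynomial inequalities in [y]: [sin] and [cos] are replaced by alternating Taylor polynomials, and [sinh x] by its Taylor polynomial of degree 5 plus the Lagrange remainder [cosh c * x^7 / 5040]. Positivity of [cos] bounds [y] well enough that [PI <= 4] is the only estimate of [PI] needed. *)
Require Import Defs.
From Stdlib Require Import Reals Factorial Lra.
From Coquelicot Require Import Coquelicot.
Open Scope R_scope.

(** Unfolds factorials into products of integer literals, which [field] can compute with. *)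
Lemma INR_fact_S (n : nat) : INR (fact (S n)) = IZR (Z.of_nat (S n)) * INR (fact n).
Proof. rewrite <- INR_IZR_INZ, <- mult_INR; reflexivity. Qed.

Lemma is_derive_n_sinh (n : nat) (t : R) :
  is_derive_n sinh n t (if Nat.even n then sinh t else cosh t).
Proof.
  revert t; induction n as [|n IH]; intro t; [reflexivity|].
  change (is_derive (Derive_n sinh n) t
            (if Nat.even (S n) then sinh t else cosh t)).
  apply is_derive_ext with (f := if Nat.even n then sinh else cosh).
  - intro u; rewrite (is_derive_n_unique _ _ _ _ (IH u)).
    now destruct (Nat.even n).
  - rewrite Nat.even_succ, <- Nat.negb_even.
    destruct (Nat.even n); simpl; apply is_derive_Reals.
    + apply derivable_pt_lim_sinh.
    + apply derivable_pt_lim_cosh.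
Qed.

Lemma sinh_taylor7 (x : R) (hx : 0 < x) :
  exists c, 0 < c < x /\
    sinh x = x + x ^ 3 / 6 + x ^ 5 / 120 + cosh c * x ^ 7 / 5040.
Proof.
  (* Order 6 rather than 5: the even derivatives vanish at 0, so the remainder moves to order 7 at
     no cost. *)
  destruct (Taylor_Lagrange sinh 6 0 x hx) as [c [hc H]].
  { intros t _ [|k] _; [exact I|].
    eexists; exact (is_derive_n_sinh (S k) t). }
  exists c; split; [exact hc|].
  rewrite H, (is_derive_n_unique _ _ _ _ (is_derive_n_sinh 7 c)).
  cbn [sum_f_R0].
  rewrite !(fun k => is_derive_n_unique _ _ _ _ (is_derive_n_sinh k 0)).
  cbn [Nat.even]; rewrite sinh_0, cosh_0.
  rewrite !INR_fact_S; simpl; field.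
Qed.

(** AM-GM for [exp x] and [exp (- x)], whose product is 1. *)
Lemma cosh_ge_1 (x : R) : 1 <= cosh x.
Proof.
  unfold cosh; pose proof (exp_pos x); pose proof (exp_pos (- x)).
  assert (exp x * exp (- x) = 1) by
    (rewrite <- exp_plus, Rplus_opp_r; apply exp_0).
  pose proof (pow2_ge_0 (exp x - exp (- x))).
  assert (2 ^ 2 <= (exp x + exp (- x)) ^ 2) by lra.
  enough (2 <= exp x + exp (- x)) by lra.
  apply Rsqr_incr_0; unfold Rsqr; lra.
Qed.

(** Both exponents are at most 2, and [exp 1 <= 3] gives 9 = 3^2. *)
Lemma cosh_le_9 (x : R) (hx : 0 <= x <= 2) : cosh x <= 9.
Proof.
  assert (forall u, u <= 2 -> exp u <= 9) as B.
  { intros u hu; apply Rle_trans with (exp (1 + 1)).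
    - destruct (Req_dec u 2) as [->|]; [right; f_equal; ring|].
      left; apply exp_increasing; lra.
    - rewrite exp_plus; pose proof exp_le_3; pose proof (exp_pos 1); nra. }
  unfold cosh; pose proof (B x ltac:(lra)); pose proof (B (- x) ltac:(lra)); lra.
Qed.

Lemma sin_lower3 (x : R) (hx : 0 <= x <= 4) : x - x ^ 3 / 6 <= sin x.
Proof.
  (* Index n gives a lower sum ending at term 2n+1 and an upper sum ending at term 2n+2; likewise
     for [pre_cos_bound]. *)
  destruct (pre_sin_bound x 0) as [H _]; try lra.
  eapply Rle_trans; [right | exact H].
  unfold sin_approx, sin_term; cbn [sum_f_R0 Nat.mul Nat.add].
  rewrite !INR_fact_S; simpl; field.
Qed.

Lemma sin_upper9 (x : R) (hx : 0 <= x <= 4) :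
  sin x <= x - x ^ 3 / 6 + x ^ 5 / 120 - x ^ 7 / 5040 + x ^ 9 / 362880.
Proof.
  destruct (pre_sin_bound x 1) as [_ H]; try lra.
  eapply Rle_trans; [exact H | right].
  unfold sin_approx, sin_term; cbn [sum_f_R0 Nat.mul Nat.add].
  rewrite !INR_fact_S; simpl; field.
Qed.

Lemma cos_upper4 (x : R) (hx : -2 <= x <= 2) :
  cos x <= 1 - x ^ 2 / 2 + x ^ 4 / 24.
Proof.
  destruct (pre_cos_bound x 0) as [_ H]; try lra.
  eapply Rle_trans; [exact H | right].
  unfold cos_approx, cos_term; cbn [sum_f_R0 Nat.mul Nat.add].
  rewrite !INR_fact_S; simpl; field.
Qed.

Lemma cos_lower6 (x : R) (hx : -2 <= x <= 2) :
  1 - x ^ 2 / 2 + x ^ 4 / 24 - x ^ 6 / 720 <= cos x.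
Proof.
  destruct (pre_cos_bound x 1) as [H _]; try lra.
  eapply Rle_trans; [right | exact H].
  unfold cos_approx, cos_term; cbn [sum_f_R0 Nat.mul Nat.add].
  rewrite !INR_fact_S; simpl; field.
Qed.

Theorem theorem2 (x : R) (hx : 0 < x < PI / 2) :
  sinh x / x + (x / tan x) ^ 2 < 2 - x ^ 2 / 6 /\
  2 - x ^ 2 / 6 < 2 /\
  2 < 2 + x ^ 5 / (45 * tan x) /\
  2 + x ^ 5 / (45 * tan x) < (sinh x / x) ^ 2 + x / tan x.
Proof.
  pose proof PI_4 as hpi.
  assert (0 < sin x) as hs by (apply sin_gt_0; lra).
  assert (0 < cos x) as hc by (apply cos_gt_0; lra).
  pose proof (sin_lower3 x ltac:(lra)) as s3.
  pose proof (sin_upper9 x ltac:(lra)) as s9.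
  pose proof (cos_upper4 x ltac:(lra)) as c4.
  pose proof (cos_lower6 x ltac:(lra)) as c6.
  destruct (sinh_taylor7 x ltac:(lra)) as [c [hcx hsinh]].
  pose proof (cosh_ge_1 c) as ch1.
  pose proof (cosh_le_9 c ltac:(lra)) as ch9.
  remember (x ^ 2) as y eqn:hy.
  assert (0 < y <= 4) as hy4 by (subst y; nra).
  replace (x ^ 4) with (y ^ 2) in * by (subst y; ring).
  replace (x ^ 6) with (y ^ 3) in * by (subst y; ring).
  (* [0 < cos x] makes the quadratic in [c4] positive. Its roots are 6 - sqrt 12 and 6 + sqrt 12, so
     [y <= 4] leaves y < 6 - sqrt 12, about 2.536. *)
  assert (y < 254 / 100) as hy2 by nra.
  set (k := x / tan x).
  assert (k * sin x = x * cos x) as hk by (unfold k, tan; field; lra).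
  assert (0 < k) as hk0 by nra.
  replace (x ^ 5 / (45 * tan x)) with (y ^ 2 * k / 45)
    by (subst y; unfold k, tan; field; lra).
  set (S := sinh x / x).
  assert (S = 1 + y / 6 + y ^ 2 / 120 + cosh c * y ^ 3 / 5040) as hS
    by (unfold S; rewrite hsinh; subst y; field; lra).
  assert (0 < y ^ 2) by nra.
  assert (0 < y ^ 3) by nra.
  split; [|split; [lra|split; [nra|]]].
  - assert (k <= 1 - y / 3) as hkle.
    (* After multiplication by [sin x], [c4] and [s3] reduce the claim to 1 - y/2 + y^2/24 <= (1 -
       y/3) (1 - y/6), where the right side has y^2/18. Multiplying [s3] by 1 - y/3 requires y <
       3. *)
    { apply Rmult_le_reg_r with (sin x); [exact hs|]; rewrite hk.
      apply Rle_trans with (x * (1 - y / 2 + y ^ 2 / 24)); [nra|].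
      apply Rle_trans with ((1 - y / 3) * (x - x ^ 3 / 6)); [|nra].
      replace (x ^ 3) with (x * y) by (subst y; ring).
      nra. }
    assert (S <= 1 + y / 6 + y ^ 2 / 120 + 9 * y ^ 3 / 5040) by nra.
    assert (k ^ 2 <= (1 - y / 3) ^ 2) by nra.
    (* Divided by y, this is 43 y/360 + y^2/560 < 1/3; at y = 2.54 the left side is about 0.315. *)
    nra.
  (* 2 - Q is the square of 1 + y/6 + y^2/120 without its last term y^4/14400. *)
  - set (Q := 1 - y / 3 - 2 * y ^ 2 / 45 - y ^ 3 / 360).
    assert (2 - Q <= S ^ 2) as hQ.
    { assert (1 + y / 6 + y ^ 2 / 120 <= S) by nra.
      unfold Q; nra. }
    enough (Q < (1 - y ^ 2 / 45) * k) by lra.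
    assert (0 < 1 - y ^ 2 / 45) by nra.
    (* For Q <= 0 the right side is already positive; otherwise [s9] may be multiplied by Q. *)
    destruct (Rle_lt_dec Q 0) as [hQ0|hQ0]; [nra|].
    apply Rmult_lt_reg_r with (sin x); [exact hs|].
    rewrite Rmult_assoc, hk.
    apply Rle_lt_trans with
      (x * (Q * (1 - y / 6 + y ^ 2 / 120 - y ^ 3 / 5040 + y ^ 4 / 362880))).
    { replace (x * (Q * _)) with
        (Q * (x - x ^ 3 / 6 + x ^ 5 / 120 - x ^ 7 / 5040 + x ^ 9 / 362880))
        by (subst y; field).
      apply Rmult_le_compat_l; lra. }
    apply Rlt_le_trans with
      (x * ((1 - y ^ 2 / 45) * (1 - y / 2 + y ^ 2 / 24 - y ^ 3 / 720))).
    + apply Rmult_lt_compat_l; [lra|].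
      (* Both sides agree through y^2; right minus left begins with 61 y^3/7560, which supplies the
         strictness. *)
      unfold Q; nra.
    + rewrite <- Rmult_assoc, (Rmult_comm x), Rmult_assoc.
      apply Rmult_le_compat_l; [lra|].
      apply Rmult_le_compat_l; lra.
Qed.
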